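(* The class of pseudo BL-rings is closed under each of the following operations: (1) finite direct products; (2) arbitrary direct sums; (3) homomorphic images.
   Context: Rings are associative, not necessarily commutative, and not assumed to have an identity unless stated; ''ideal'' means two-sided ideal. A ring $R$ is generated by idempotents if for every $x\in R$ there is an idempotent $e\in R$ ($e^2=e$) with $ex=xe=x$. For ideals $I,J$ of $R$, $I\cdot J$ is the usual product of ideals (finite sums of products $ab$, $a\in I$, $b\in J$), $I\rightarrow J:=\{x\in R\mid xI\subseteq J\}$ and $I\rightsquigarrow J:=\{x\in R\mid Ix\subseteq J\}$. A ring $R$ generated by idempotents is called a pseudo BL-ring if for all ideals $I,J$ of $R$: (PBLR-1) $I\cap J=I\cdot(I\rightsquigarrow J)=(I\rightarrow J)\cdot I$; and (PBLR-2) $(I\rightarrow J)+(J\rightarrow I)=(I\rightsquigarrow J)+(J\rightsquigarrow I)=R$. *)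

(* Defs.v *)
From HB Require Import structures.
From mathcomp Require Import all_boot all_algebra.
From mathcomp Require Import boolp classical_sets cardinality.

Set Implicit Arguments.
Unset Strict Implicit.
Unset Printing Implicit Defensive.

Import GRing.Theory.

Local Open Scope classical_set_scope.
Local Open Scope ring_scope.
Local Open Scope group_scope.

(* Associative rings, possibly without 1.  The pzRingType hierarchy requires a
   unit, so the multiplication used here is the semigroup product (x * y)%g. *)
HB.mixin Record Zmodule_Semigroup_isRng R
    of GRing.Zmodule R & Semigroup R := {
  rng_mulDl : left_distributive (@monoid.mul R) +%R;
  rng_mulDr : right_distributive (@monoid.mul R) +%R
}.

#[short(type="rngType")]
HB.structure Definition Rng :=
  {R of Zmodule_Semigroup_isRng R & GRing.Zmodule R & Semigroup R}.

HB.structure Definition RngMorphism (R S : rngType) :=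
  {f of @Multiplicative R S f & @GRing.Additive R S f}.

Notation "{ 'rng_morphism' R -> S }" := (RngMorphism.type R S)
  (at level 0, R at level 98, S at level 99,
   format "{ 'rng_morphism'  R  ->  S }") : type_scope.

Section DirectProduct.
Variables (I : Type) (R : I -> rngType).

Definition rng_prod := forall i, R i.

HB.instance Definition _ := Choice.on rng_prod.

Implicit Types f g h : rng_prod.

Definition rng_prod_zero : rng_prod := fun=> 0.
Definition rng_prod_opp f : rng_prod := fun i => - f i.
Definition rng_prod_add f g : rng_prod := fun i => f i + g i.
Definition rng_prod_mul f g : rng_prod := fun i => f i * g i.

Fact rng_prod_addA : associative rng_prod_add.
Proof. by move=> f g h; apply: functional_extensionality_dep => i; exact: addrA. Qed.

Fact rng_prod_addC : commutative rng_prod_add.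
Proof. by move=> f g; apply: functional_extensionality_dep => i; exact: addrC. Qed.

Fact rng_prod_add0 : left_id rng_prod_zero rng_prod_add.
Proof. by move=> f; apply: functional_extensionality_dep => i; exact: add0r. Qed.

Fact rng_prod_addN : left_inverse rng_prod_zero rng_prod_opp rng_prod_add.
Proof. by move=> f; apply: functional_extensionality_dep => i; exact: addNr. Qed.

HB.instance Definition _ := GRing.isZmodule.Build rng_prod
  rng_prod_addA rng_prod_addC rng_prod_add0 rng_prod_addN.

Fact rng_prod_mulA : associative rng_prod_mul.
Proof. by move=> f g h; apply: functional_extensionality_dep => i; exact: mulgA. Qed.

HB.instance Definition _ := isSemigroup.Build rng_prod rng_prod_mulA.

Fact rng_prod_mulDl : left_distributive (@monoid.mul rng_prod) +%R.
Proof. by move=> f g h; apply/functional_extensionality_dep=> i; exact: rng_mulDl. Qed.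

Fact rng_prod_mulDr : right_distributive (@monoid.mul rng_prod) +%R.
Proof. by move=> f g h; apply/functional_extensionality_dep=> i; exact: rng_mulDr. Qed.

HB.instance Definition _ := Zmodule_Semigroup_isRng.Build rng_prod
  rng_prod_mulDl rng_prod_mulDr.

End DirectProduct.

Section DirectSum.
Variables (I : Type) (R : I -> rngType).

Definition finite_support : {pred rng_prod R} :=
  fun f => `[< finite_set [set i | f i <> 0] >].

Definition rng_sum := {f : rng_prod R | f \in finite_support}.

HB.instance Definition _ := [isSub of rng_sum for @sval _ _].
HB.instance Definition _ := [Choice of rng_sum by <:].

Fact finite_support_zmod_closed : zmod_closed finite_support.
Proof.
split=> [|f g /asboolP fF /asboolP gF]; apply/asboolP.
  by apply: (sub_finite_set _ (finite_set0 I)) => i; case.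
have := conj fF gF; rewrite -finite_setU => fgF.
apply: (sub_finite_set _ fgF) => i fg0; apply: contrapT => /not_orP[f0 g0].
apply: fg0; change (f i - g i = 0).
have -> : f i = 0 := contrapT f0.
have -> : g i = 0 := contrapT g0.
exact: subr0.
Qed.

HB.instance Definition _ :=
  GRing.SubChoice_isSubZmodule.Build (rng_prod R) finite_support rng_sum
    finite_support_zmod_closed.

Fact finite_support_mulg_closed : mulg_closed finite_support.
Proof.
move=> f g /asboolP fF _; apply/asboolP; apply: (sub_finite_set _ fF) => i.
apply: contra_not => f0; change (f i * g i = 0); rewrite f0.
by apply: (@addrI _ (0 * g i)); rewrite -rng_mulDl !addr0.
Qed.

HB.instance Definition _ :=
  SubChoice_isSubSemigroup.Build (rng_prod R) finite_support rng_sum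
    finite_support_mulg_closed.

Fact rng_sum_mulDl : left_distributive (@monoid.mul rng_sum) +%R.
Proof. by move=> f g h; apply: val_inj; exact: rng_mulDl. Qed.

Fact rng_sum_mulDr : right_distributive (@monoid.mul rng_sum) +%R.
Proof. by move=> f g h; apply: val_inj; exact: rng_mulDr. Qed.

HB.instance Definition _ := Zmodule_Semigroup_isRng.Build rng_sum
  rng_sum_mulDl rng_sum_mulDr.

End DirectSum.

Section PseudoBL.
Variable R : rngType.
Implicit Types I J : set R.

Record is_ideal I : Prop := IsIdeal {
  is_ideal0 : I 0;
  is_idealB : forall x y, I x -> I y -> I (x - y);
  is_idealMl : forall r x, I x -> I (r * x);
  is_idealMr : forall x r, I x -> I (x * r)
}.

Definition ideal_add I J : set R := [set a + b | a in I & b in J].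

Definition ideal_mul I J : set R :=
  [set x : R | exists n (a b : 'I_n -> R),
    [/\ forall i, I (a i), forall i, J (b i)
       & x = (\sum_(i < n) (a i * b i)%g)%R]].

(* I -> J is {x | xI <= J} and I ~> J is {x | Ix <= J}. *)
Definition ideal_imp I J : set R := [set x : R | forall a, I a -> J (x * a)].
Definition ideal_pimp I J : set R := [set x : R | forall a, I a -> J (a * x)].

Definition generated_by_idempotents :=
  forall x : R, exists e : R, [/\ e * e = e, e * x = x & x * e = x].

Definition pseudo_BL_ring : Prop :=
  generated_by_idempotents /\
  forall I J, is_ideal I -> is_ideal J ->
    [/\ I `&` J = ideal_mul I (ideal_pimp I J),
        I `&` J = ideal_mul (ideal_imp I J) I,
        ideal_add (ideal_imp I J) (ideal_imp J I) = [set: R]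
      & ideal_add (ideal_pimp I J) (ideal_pimp J I) = [set: R]].

End PseudoBL.

Arguments pseudo_BL_ring : clear implicits.

(* Main.v *)
From HB Require Import structures.
Require Import Defs.
From mathcomp Require Import all_boot all_algebra.
From mathcomp Require Import boolp classical_sets cardinality.

Import GRing.Theory.

Local Open Scope classical_set_scope.

(* If R_i is generated by idempotents for every i, an ideal I of the direct sum
   splits as the sum of the ideals I_i = {r | inj_i r in I}: for x in I and an
   idempotent e with e x_i = x_i one has inj_i x_i = inj_i e * x in I.  The
   residuals of I_i and J_i embed into those of I and J, so the axioms can be
   checked componentwise.  The same argument, with a surjective morphism in
   place of the injections and a section of it in place of the projections,
   gives homomorphic images (rng_morphism_family_pseudo_BL covers both), and a
   finite product is an image of the direct sum. *)

Set Implicit Arguments.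
Unset Strict Implicit.
Unset Printing Implicit Defensive.

(** * Closure of ideal operations under zero and addition *)

Section RngTheory.
Variable R : rngType.
Implicit Types (x : R) (I J : set R).

Lemma rng_mul0 x : (0%R * x)%g = 0%R.
Proof. by apply: (@addrI _ (0%R * x)%g); rewrite -rng_mulDl !addr0. Qed.

Lemma rng_mulr0 x : (x * 0%R)%g = 0%R.
Proof. by apply: (@addrI _ (x * 0%R)%g); rewrite -rng_mulDr !addr0. Qed.

Lemma is_idealD I x y : is_ideal I -> I x -> I y -> I (x + y)%R.
Proof.
move=> idI Ix Iy; rewrite -[y]opprK; apply: (is_idealB idI) => //.
by rewrite -[(- y)%R]add0r; apply: (is_idealB idI) => //; exact: is_ideal0.
Qed.

Lemma is_ideal_sum I n (a : 'I_n -> R) :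
  is_ideal I -> (forall i, I (a i)) -> I (\sum_(i < n) a i)%R.
Proof.
move=> idI Ia; apply: (big_ind I) => // [|x y]; first exact: is_ideal0.
exact: is_idealD.
Qed.

Lemma ideal_mul_sub I J K : is_ideal K ->
  (forall a b, I a -> J b -> K (a * b)%g) -> ideal_mul I J `<=` K.
Proof.
move=> idK IJK _ [n [a [b [Ia Jb ->]]]].
by apply: is_ideal_sum => // i; exact: IJK.
Qed.

Lemma ideal_mul0 I J : ideal_mul I J 0%R.
Proof. by exists 0, (fun=> 0%R), (fun=> 0%R); split => [[]//|[]//|]; rewrite big_ord0. Qed.

Lemma ideal_mulD I J x y :
  ideal_mul I J x -> ideal_mul I J y -> ideal_mul I J (x + y)%R.
Proof.
move=> [n [a [b [Ia Jb ->]]]] [m [c [d [Ic Jd ->]]]].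
(* The two families of factors are concatenated: the first [n] indices give the products for [x],
   the last [m] those for [y]. *)
exists (n + m)%N, (fun k => match split k with inl i => a i | inr j => c j end),
  (fun k => match split k with inl i => b i | inr j => d j end).
split=> [k|k|]; try by case: (split k).
rewrite big_split_ord /=; congr (_ + _)%R; apply: eq_bigr => i _.
  by rewrite (unsplitK (inl i)).
by rewrite (unsplitK (inr i)).
Qed.

Lemma ideal_imp0 I J : is_ideal J -> ideal_imp I J 0%R.
Proof. by move=> idJ a _; rewrite rng_mul0; exact: is_ideal0. Qed.

Lemma ideal_pimp0 I J : is_ideal J -> ideal_pimp I J 0%R.
Proof. by move=> idJ a _; rewrite rng_mulr0; exact: is_ideal0. Qed.

Lemma ideal_impD I J x y : is_ideal J ->
  ideal_imp I J x -> ideal_imp I J y -> ideal_imp I J (x + y)%R.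
Proof.
by move=> idJ Hx Hy a Ia; rewrite rng_mulDl; apply: is_idealD; auto.
Qed.

Lemma ideal_pimpD I J x y : is_ideal J ->
  ideal_pimp I J x -> ideal_pimp I J y -> ideal_pimp I J (x + y)%R.
Proof.
by move=> idJ Hx Hy a Ia; rewrite rng_mulDr; apply: is_idealD; auto.
Qed.

Lemma ideal_add0 I J : I 0%R -> J 0%R -> ideal_add I J 0%R.
Proof. by move=> I0 J0; exists 0%R => //; exists 0%R => //; rewrite addr0. Qed.

Lemma ideal_addD I J x y :
  (forall a b, I a -> I b -> I (a + b)%R) ->
  (forall a b, J a -> J b -> J (a + b)%R) ->
  ideal_add I J x -> ideal_add I J y -> ideal_add I J (x + y)%R.
Proof.
move=> ID JD [a Ia [b Jb <-]] [c Ic [d Jd <-]].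
by exists (a + c)%R; [exact: ID|exists (b + d)%R; [exact: JD|rewrite addrACA]].
Qed.

End RngTheory.

(** * Ideals along morphisms *)

Section RngMorphismTheory.
Variables (R S : rngType) (f : {rng_morphism R -> S}).

Lemma rng_morphism_preimage_ideal (I : set S) :
  is_ideal I -> is_ideal (f @^-1` I).
Proof.
move=> idI; split=> [|x y Ix Iy|r x Ix|x r Ix] /=.
- by rewrite raddf0; exact: is_ideal0.
- by rewrite raddfB; exact: is_idealB.
- by rewrite gmulfM; exact: is_idealMl.
- by rewrite gmulfM; exact: is_idealMr.
Qed.

Lemma rng_morphism_ideal_mul (I J : set R) (I' J' : set S) x :
  I `<=` f @^-1` I' -> J `<=` f @^-1` J' ->
  ideal_mul I J x -> ideal_mul I' J' (f x).
Proof.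
move=> II' JJ' [n [a [b [Ia Jb ->]]]].
exists n, (f \o a), (f \o b); split=> [i|i|]; [exact: II'|exact: JJ'|].
by rewrite raddf_sum; apply: eq_bigr => i _; rewrite gmulfM.
Qed.

Lemma rng_morphism_ideal_add (I J : set R) (I' J' : set S) x :
  I `<=` f @^-1` I' -> J `<=` f @^-1` J' ->
  ideal_add I J x -> ideal_add I' J' (f x).
Proof.
move=> II' JJ' [a Ia [b Jb <-]].
by exists (f a); [exact: II'|exists (f b); [exact: JJ'|rewrite raddfD]].
Qed.

End RngMorphismTheory.

(** * Componentwise criterion for pseudo BL-rings *)

Section MorphismFamily.
Variables (K : Type) (R : K -> rngType) (S : rngType).
Variables (f : forall k, {rng_morphism R k -> S}) (p : forall k, S -> R k).
(** Projection formulas. The maps [p k] are not assumed additive or multiplicative, so that an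
    arbitrary set-theoretic section is allowed. *)
Hypothesis mul_f : forall k r s, (s * f k r)%g = f k (p k s * r)%g.
Hypothesis f_mul : forall k r s, (f k r * s)%g = f k (r * p k s)%g.
(** Plays the role of the decomposition of [s] as the sum of its components [f k (p k s)], without
    writing a sum over a possibly infinite [K]. *)
Hypothesis f_p_ind : forall (P : set S) s, P 0%R ->
  (forall x y, P x -> P y -> P (x + y)%R) -> (forall k, P (f k (p k s))) -> P s.
Hypothesis R_BL : forall k, pseudo_BL_ring (R k).

Lemma ideal_component (I : set S) k s : is_ideal I -> I s -> I (f k (p k s)).
Proof.
move=> idI Is; have [e [_ <- _]] := (R_BL k).1 (p k s).
by rewrite -f_mul; exact: is_idealMl.
Qed.

(** The projection formula turns [f k x * a] into [f k (x * p k a)], and [p k a] lies in the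
    preimage of [I] by [ideal_component]. *)
Lemma ideal_imp_component (I J : set S) k : is_ideal I -> is_ideal J ->
  ideal_imp (f k @^-1` I) (f k @^-1` J) `<=` f k @^-1` ideal_imp I J.
Proof.
by move=> idI idJ x Hx a Ia; rewrite f_mul; apply: Hx; exact: ideal_component.
Qed.

Lemma ideal_pimp_component (I J : set S) k : is_ideal I -> is_ideal J ->
  ideal_pimp (f k @^-1` I) (f k @^-1` J) `<=` f k @^-1` ideal_pimp I J.
Proof.
by move=> idI idJ x Hx a Ia; rewrite mul_f; apply: Hx; exact: ideal_component.
Qed.

(** The right-hand sides of the axioms contain zero and are closed under addition, so [f_p_ind]
    reduces membership of [s] to that of its components, where the axiom of [R k] for the preimage
    ideals applies. *)
Lemma rng_morphism_family_pseudo_BL :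
  generated_by_idempotents S -> pseudo_BL_ring S.
Proof.
move=> S_idem; split=> // I J idI idJ.
have BL k := (R_BL k).2 _ _ (rng_morphism_preimage_ideal (f k) idI)
                            (rng_morphism_preimage_ideal (f k) idJ).
have comp k s : (I `&` J) s -> (f k @^-1` I `&` f k @^-1` J) (p k s).
  by move=> [Is Js]; split; exact: ideal_component.
split.
- apply/seteqP; split=> s.
    move=> IJs; apply: f_p_ind => [||k]; first exact: ideal_mul0.
      exact: ideal_mulD.
    have [eqk _ _ _] := BL k; move: (comp k s IJs); rewrite eqk.
    by apply: rng_morphism_ideal_mul => //; exact: ideal_pimp_component.
  (* This inclusion holds in any ring: a product lies in [I] by absorption and in [J] by definition
     of the residual. *)
  move=> IJs; split.
    by move: IJs; apply: ideal_mul_sub => // a b Ia _; exact: is_idealMr.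
  by move: IJs; apply: ideal_mul_sub => // a b Ia; exact.
- apply/seteqP; split=> s.
    move=> IJs; apply: f_p_ind => [||k]; first exact: ideal_mul0.
      exact: ideal_mulD.
    have [_ eqk _ _] := BL k; move: (comp k s IJs); rewrite eqk.
    by apply: rng_morphism_ideal_mul => //; exact: ideal_imp_component.
  move=> IJs; split.
    by move: IJs; apply: ideal_mul_sub => // a b _ Ib; exact: is_idealMl.
  by move: IJs; apply: ideal_mul_sub => // a b; exact.
- rewrite -subTset => s _; apply: f_p_ind => [||k].
  + by apply: ideal_add0; exact: ideal_imp0.
  + by move=> x y; apply: ideal_addD => ? ?; exact: ideal_impD.
  + have [_ _ eqk _] := BL k; have : [set: R k] (p k s) by [].
    by rewrite -eqk; apply: rng_morphism_ideal_add; exact: ideal_imp_component.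
- rewrite -subTset => s _; apply: f_p_ind => [||k].
  + by apply: ideal_add0; exact: ideal_pimp0.
  + by move=> x y; apply: ideal_addD => ? ?; exact: ideal_pimpD.
  + have [_ _ _ eqk] := BL k; have : [set: R k] (p k s) by [].
    by rewrite -eqk; apply: rng_morphism_ideal_add; exact: ideal_pimp_component.
Qed.

End MorphismFamily.

Lemma rng_morphism_image_pseudo_BL (R S : rngType) (f : {rng_morphism R -> S}) :
  range f = [set: S] -> pseudo_BL_ring R -> pseudo_BL_ring S.
Proof.
move=> f_surj R_BL.
have /choice[p fp] s : exists r, f r = s.
  by have : [set: S] s by []; rewrite -f_surj => -[r _ <-]; exists r.
(* A one-member family: the only component of [s] is [f (p s) = s], so the induction hypothesis at
   [tt] is already the goal. *)
apply: (@rng_morphism_family_pseudo_BL unit (fun=> R) S (fun=> f) (fun=> p)).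
- by move=> _ r s; rewrite gmulfM /= fp.
- by move=> _ r s; rewrite gmulfM /= fp.
- by move=> P s _ _ /(_ tt); rewrite /= fp.
- by [].
- move=> s; have [e [ee er re]] := R_BL.1 (p s).
  by exists (f e); split; rewrite -1?(fp s) -gmulfM ?ee ?er ?re.
Qed.

(** * Direct sums and their canonical injections *)

Section DirectSumInjection.
Variables (I : eqType) (R : I -> rngType).

Lemma rng_sum_inj_subproof i (x : R i) :
  (dfwith (fun j => 0%R : R j) x : rng_prod R) \in @finite_support I R.
Proof.
apply/asboolP; apply: (sub_finite_set _ (finite_set1 i)) => j.
by apply: contra_notP => /eqP ji; rewrite dfwith_out // eq_sym.
Qed.

Definition rng_sum_inj i (x : R i) : rng_sum R :=
  exist _ (dfwith (fun j => 0%R : R j) x) (rng_sum_inj_subproof x).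

Lemma rng_sum_inj_in i (x : R i) : val (rng_sum_inj x) i = x.
Proof. exact: dfwith_in. Qed.

Lemma rng_sum_inj_out i j (x : R i) : i != j -> val (rng_sum_inj x) j = 0%R.
Proof. exact: dfwith_out. Qed.

Lemma rng_sum_eqP (u v : rng_sum R) : (forall i, val u i = val v i) -> u = v.
Proof. by move=> uv; apply/val_inj/functional_extensionality_dep. Qed.

Lemma rng_sum_inj_is_additive i : zmod_morphism (@rng_sum_inj i).
Proof.
move=> x y; apply: rng_sum_eqP => j.
change (val (rng_sum_inj (x - y)%R) j
        = (val (rng_sum_inj x) j - val (rng_sum_inj y) j)%R).
have [<-|ij] := eqVneq i j; first by rewrite !rng_sum_inj_in.
by rewrite !rng_sum_inj_out // subr0.
Qed.

Lemma rng_sum_mul_inj i (r : R i) (s : rng_sum R) :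
  (s * rng_sum_inj r)%g = rng_sum_inj (val s i * r)%g.
Proof.
apply: rng_sum_eqP => j.
change ((val s j * val (rng_sum_inj r) j)%g = val (rng_sum_inj (val s i * r)%g) j).
have [<-|ij] := eqVneq i j; first by rewrite !rng_sum_inj_in.
by rewrite !rng_sum_inj_out // rng_mulr0.
Qed.

Lemma rng_sum_inj_mul i (r : R i) (s : rng_sum R) :
  (rng_sum_inj r * s)%g = rng_sum_inj (r * val s i)%g.
Proof.
apply: rng_sum_eqP => j.
change ((val (rng_sum_inj r) j * val s j)%g = val (rng_sum_inj (r * val s i)%g) j).
have [<-|ij] := eqVneq i j; first by rewrite !rng_sum_inj_in.
by rewrite !rng_sum_inj_out // rng_mul0.
Qed.

Lemma rng_sum_inj_is_multiplicative i :
  {morph @rng_sum_inj i : x y / (x * y)%g >-> (x * y)%g}.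
Proof. by move=> x y; rewrite rng_sum_mul_inj rng_sum_inj_in. Qed.

HB.instance Definition _ i :=
  GRing.isZmodMorphism.Build (R i) (rng_sum R) (@rng_sum_inj i)
    (@rng_sum_inj_is_additive i).
HB.instance Definition _ i :=
  isMultiplicative.Build (R i) (rng_sum R) (@rng_sum_inj i)
    (@rng_sum_inj_is_multiplicative i).

(** Induction on a list [l] containing the support, with [s] generalized: subtracting the component
    at the head leaves an element supported in the tail. *)
Lemma rng_sum_ind (P : set (rng_sum R)) (s : rng_sum R) : P 0%R ->
  (forall x y, P x -> P y -> P (x + y)%R) ->
  (forall i, P (rng_sum_inj (val s i))) -> P s.
Proof.
move=> P0 PD; have /asboolP/finite_seqP[l sl] := valP s.
have {sl} : forall i, val s i <> 0%R -> i \in l.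
  by move=> i si; have : [set` l] i by rewrite -sl.
elim: l s => [|i l IHl] s sl Ps.
  suff -> : s = 0%R by [].
  by apply: rng_sum_eqP => j; apply: contrapT => /sl.
rewrite -[s](subrK (rng_sum_inj (val s i))); apply: (PD) => //.
set t := (s - _)%R.
have ti : val t i = 0%R.
  change ((val s i - val (rng_sum_inj (val s i)) i)%R = 0%R).
  by rewrite rng_sum_inj_in subrr.
have tj j : i != j -> val t j = val s j.
  move=> ij; change ((val s j - val (rng_sum_inj (val s i)) j)%R = val s j).
  by rewrite rng_sum_inj_out // subr0.
apply: IHl => j; have [<-|ij] := eqVneq i j.
- by rewrite ti.
- by rewrite tj // => /sl; rewrite inE eq_sym (negbTE ij).
(* The components of [t] satisfy [P]: the one at [i] is now zero, the others are those of [s]. *)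
- by rewrite ti raddf0.
- by rewrite tj.
Qed.

Lemma rng_sum_generated_by_idempotents :
  (forall i, generated_by_idempotents (R i)) ->
  generated_by_idempotents (rng_sum R).
Proof.
move=> R_idem x.
(* The last clause forces the idempotent to vanish wherever [x] does, so that the family of choices
   has finite support. *)
have E i : exists e : R i, [/\ (e * e = e)%g, (e * val x i)%g = val x i,
    (val x i * e)%g = val x i & val x i = 0%R -> e = 0%R].
  have [xi0|xi0] := pselect (val x i = 0%R).
    by exists 0%R; rewrite xi0; split; rewrite ?rng_mul0 //.
  by have [e [ee ex xe]] := R_idem i (val x i); exists e; split.
pose e : rng_prod R := fun i => sval (cid (E i)).
have eP i : [/\ (e i * e i = e i)%g, (e i * val x i)%g = val x i,
    (val x i * e i)%g = val x i & val x i = 0%R -> e i = 0%R].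
  exact: svalP (cid (E i)).
have e_fin : e \in @finite_support I R.
  apply/asboolP; have /asboolP := valP x; apply: sub_finite_set => i.
  by apply: contra_not => xi0; have [_ _ _ ->] := eP i.
exists (exist _ e e_fin); split; apply: rng_sum_eqP => i.
- by have [] := eP i.
- by have [] := eP i.
- by have [] := eP i.
Qed.

Lemma rng_sum_pseudo_BL_eqType :
  (forall i, pseudo_BL_ring (R i)) -> pseudo_BL_ring (rng_sum R).
Proof.
move=> R_BL.
apply: (@rng_morphism_family_pseudo_BL I R (rng_sum R)
  (fun i => @rng_sum_inj i) (fun i s => val s i)) => //.
- exact: rng_sum_mul_inj.
- exact: rng_sum_inj_mul.
- exact: rng_sum_ind.
- by apply: rng_sum_generated_by_idempotents => i; case: (R_BL i).
Qed.

End DirectSumInjection.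

Lemma rng_sum_pseudo_BL (I : Type) (R : I -> rngType) :
  (forall i, pseudo_BL_ring (R i)) -> pseudo_BL_ring (rng_sum R).
(* Classical logic equips [I] with the decidable equality that the injections need. *)
Proof. exact: (@rng_sum_pseudo_BL_eqType {classic I} R). Qed.

(** * Finite products as images of direct sums *)

Section DirectSumInclusion.
Variables (I : Type) (R : I -> rngType).

Definition rng_sum_incl (x : rng_sum R) : rng_prod R := sval x.

Lemma rng_sum_incl_is_additive : zmod_morphism rng_sum_incl.
Proof. by []. Qed.

Lemma rng_sum_incl_is_multiplicative :
  {morph rng_sum_incl : x y / (x * y)%g >-> (x * y)%g}.
Proof. by []. Qed.

HB.instance Definition _ :=
  GRing.isZmodMorphism.Build (rng_sum R) (rng_prod R) rng_sum_incl
    rng_sum_incl_is_additive.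
HB.instance Definition _ :=
  isMultiplicative.Build (rng_sum R) (rng_prod R) rng_sum_incl
    rng_sum_incl_is_multiplicative.

End DirectSumInclusion.

Lemma rng_prod_pseudo_BL (I : finType) (R : I -> rngType) :
  (forall i, pseudo_BL_ring (R i)) -> pseudo_BL_ring (rng_prod R).
Proof.
move=> /rng_sum_pseudo_BL.
apply: (rng_morphism_image_pseudo_BL (f := @rng_sum_incl I R)).
rewrite -subTset => x _.
(* Over a finite index type every support is finite, so the inclusion of the sum into the product is
   onto. *)
have x_fin : x \in @finite_support I R by apply/asboolP; exact: finite_finset.
by exists (exist _ x x_fin).
Qed.

Theorem proposition3p20 :
  (forall (I : finType) (R : I -> rngType),
     (forall i, pseudo_BL_ring (R i)) -> pseudo_BL_ring (rng_prod R)) /\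
  (forall (I : Type) (R : I -> rngType),
     (forall i, pseudo_BL_ring (R i)) -> pseudo_BL_ring (rng_sum R)) /\
  (forall (R S : rngType) (f : {rng_morphism R -> S}),
     range f = [set: S] -> pseudo_BL_ring R -> pseudo_BL_ring S).
Proof.
split; first exact: rng_prod_pseudo_BL.
split; first exact: rng_sum_pseudo_BL.
exact: rng_morphism_image_pseudo_BL.
Qed.
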